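(* Let $0<p_1\le p_2\le 1$, $p_1<1$, and $x\in\mathbb R^d$ be such that $(p_1,x)\in\mathcal S$, i.e. $(1-p_1)V(x)\le(1-p_1/2)g(x)$. Then the strategy pair $(\tau^*,\gamma^* )=(0,0)$, $\mathbb P_x$-a.s., is a Nash equilibrium. Moreover, the equilibrium payoff of Player $i$ is $(1-p_i/2)g(x)$, for $i=1,2$.
   Context: **Probabilistic set-up.** A probability space $(\Omega,\mathcal F,\mathbb P)$ carries a continuous, $\mathbb R^d$-valued, strong Markov process $X$ which is regular (from any initial point it reaches any non-empty open set in finite time with positive probability), two Bernoulli random variables $\theta_1,\theta_2$ with $\mathbb P(\theta_i=1)=1-\mathbb P(\theta_i=0)=p_i$, and two Uniform$(0,1)$ random variables $U_1,U_2$; $X,\theta_1,\theta_2,U_1,U_2$ are mutually independent. $\mathcal F^X=\{\mathcal F^X_t\}_{0\le t<\infty}$ is the right-continuous augmentation of the filtration generated by $X$, $\mathcal T$ is the set of $\mathcal F^X$-stopping times, $\mathbb P_x(\cdot)=\mathbb P(\cdot\mid X_0=x)$, and $\mathbb E_x$ is the corresponding expectation. **Payoff function and single-player problem.** $r\ge 0$ is a constant and $g:\mathbb R^d\to[0,\infty)$ is continuous with $\sup_{x}g(x)>0$. Define $$V(x):=\sup_{\tau\in\mathcal T}\mathbb E_x[e^{-r\tau}g(X_\tau)1_{\{\tau<\infty\}}],\qquad \tau^*_V:=\inf\{t\ge0:V(X_t)=g(X_t)\}.$$ Standing assumption: $\mathbb E_x[\sup_{t\ge0}e^{-rt}g(X_t)]<\infty$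 for all $x\in\mathbb R^d$; $V:\mathbb R^d\to[0,\infty)$ is continuous; and $\limsup_{t\to\infty}e^{-rt}V(X_t)1_{\{\tau^*_V=+\infty\}}=0$, $\mathbb P_x$-a.s. for every $x$. **Randomised stopping times.** $\mathcal A$ is the set of right-continuous, non-decreasing, $\mathcal F^X$-adapted processes $\Gamma=\{\Gamma_t;\,0-\le t<\infty\}$ with $\Gamma_{0-}=0$ and $\Gamma_t\le1$ for all $t\ge0$. For $i=1,2$, $\mathcal T^R_i$ is the set of random times of the form $\inf\{t\ge0:\Gamma_t>U_i\}$ with $\Gamma\in\mathcal A$ (with $\inf\emptyset=\infty$). **Game.** Player 1 chooses $\tau\in\mathcal T^R_1$, Player 2 chooses $\gamma\in\mathcal T^R_2$. Put $\hat\gamma:=\gamma1_{\{\theta_1=1\}}+\infty1_{\{\theta_1=0\}}$ and $\hat\tau:=\tau1_{\{\theta_2=1\}}+\infty1_{\{\theta_2=0\}}$, and $$R_1(\tau,\gamma):=\big(g(X_\tau)1_{\{\tau<\hat\gamma\}}+\tfrac12g(X_\tau)1_{\{\tau=\hat\gamma\}}\big)1_{\{\tau<\infty\}},\qquad R_2(\tau,\gamma):=\big(g(X_\gamma)1_{\{\gamma<\hat\tau\}}+\tfrac12g(X_\gamma)1_{\{\gamma=\hat\tau\}}\big)1_{\{\gamma<\infty\}},$$ $$\mathcal J_1(\tau,\gamma;p_1,x):=\mathbb E_x[e^{-r\tau}R_1(\tau,\gamma)],\qquad \mathcal J_2(\tau,\gamma;p_2,x):=\mathbb E_x[e^{-r\gamma}R_2(\tau,\gamma)].$$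 A pair $(\tau^*,\gamma^* )\in\mathcal T^R_1\times\mathcal T^R_2$ is a Nash equilibrium (for given $x,p_1,p_2$) if $\mathcal J_1(\tau,\gamma^*;p_1,x)\le\mathcal J_1(\tau^*,\gamma^*;p_1,x)$ and $\mathcal J_2(\tau^*,\gamma;p_2,x)\le\mathcal J_2(\tau^*,\gamma^*;p_2,x)$ for all $(\tau,\gamma)\in\mathcal T^R_1\times\mathcal T^R_2$. The equilibrium payoff of Player $i$ is $\mathcal J_i(\tau^*,\gamma^*;p_i,x)$. **Stopping region.** $\mathcal S:=\{(p,x)\in(0,1)\times\mathbb R^d:(1-p)V(x)\le(1-p/2)g(x)\}$. *)

(* Defs.v *)
From mathcomp Require Import all_boot all_order all_algebra.
From mathcomp Require Import all_classical all_reals all_analysis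
  measurable_realfun.

Set Implicit Arguments.
Unset Strict Implicit.
Unset Printing Implicit Defensive.

Import Order.TTheory GRing.Theory Num.Theory.
Import numFieldNormedType.Exports.

Local Open Scope classical_set_scope.
Local Open Scope ring_scope.

(* R^d with its Borel sigma-algebra, as a measurable type.  The carrier is
   convertible to 'rV[R]_d. *)
Definition borelRd (R : realType) (d : nat) :=
  g_sigma_algebraType (@open 'rV[R]_d).

(* Processes are indexed by R; only the indices t >= 0 are meaningful, except in
   [admissible], where negative indices encode the value at time 0-.
   Random times take values in [\bar R], with +oo for "never". *)
Section process.
Context (R : realType) (d : nat) (disp : measure_display)
        (W : measurableType disp).
Implicit Types (X : R -> W -> 'rV[R]_d) (tau : W -> \bar R).

(* sigma(X_u ; 0 <= u <= s) *)
Definition past_sigma X (s : R) : set (set W) :=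
  <<s [set A | exists u (O : set 'rV[R]_d),
         [/\ 0 <= u <= s, open O & A = X u @^-1` O] ] >>.

(* F^X_t = \bigcap_(s > t) sigma(X_u ; 0 <= u <= s) *)
Definition filtrationX X (t : R) : set (set W) :=
  \bigcap_(s in [set s | t < s]) past_sigma X s.

(* sigma(X_u ; u >= 0) *)
Definition sigmaX X : set (set W) :=
  <<s [set A | exists u (O : set 'rV[R]_d),
         [/\ 0 <= u, open O & A = X u @^-1` O] ] >>.

Definition stopping_time X tau : Prop :=
  (forall w, (0 <= tau w)%E) /\
  (forall t : R, 0 <= t -> filtrationX X t [set w | (tau w <= t%:E)%E]).

(* F^X_tau *)
Definition stopped_sigma X tau : set (set W) :=
  [set A | measurable A /\
     forall t : R, 0 <= t -> filtrationX X t (A `&` [set w | (tau w <= t%:E)%E])].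

(* The product sigma-algebra on paths; by the choice of generators, its
   elements depend only on the restriction of the path to [0, +oo[. *)
Definition path_sigma : set (set (R -> 'rV[R]_d)) :=
  <<s [set B | exists u (O : set 'rV[R]_d),
         [/\ 0 <= u, open O & B = [set z | O (z u)]] ] >>.

(* X_tau on {tau < +oo}; on {tau = +oo} the value is irrelevant, and is always
   discarded below by an indicator. *)
Definition at_time X tau (w : W) : 'rV[R]_d := X (fine (tau w)) w.

Record strong_markov_process (P : probability W R)
    (Px : 'rV[R]_d -> probability W R) X : Prop := {
  process_measurable : forall t : R, 0 <= t ->
    measurable_fun [set: W] (X t : W -> borelRd R d) ;
  process_continuous : forall w,
    {within [set t | 0 <= t], continuous (X ^~ w)} ;
  (* Px is a regular conditional probability of P given X_0 ... *)
  kernel_measurable : forall A, measurable A ->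
    measurable_fun [set: borelRd R d] (Px ^~ A : borelRd R d -> \bar R) ;
  kernel_disintegration : forall (A : set W) (B : set (borelRd R d)),
    measurable A -> measurable B ->
    P (A `&` X 0 @^-1` B) = (\int[P]_(w in X 0%R @^-1` B) Px (X 0%R w) A)%E ;
  (* ... in the version of a Markov family *)
  kernel_start : forall y, Px y [set w | X 0 w = y] = 1%E ;
  strong_markov : forall y tau, stopping_time X tau ->
    forall A B, stopped_sigma X tau A -> path_sigma B ->
    Px y (A `&` [set w | (tau w < +oo)%E] `&`
          [set w | B (fun s : R => X (fine (tau w) + s)%R w)])
    = (\int[Px y]_(w in A `&` [set w | (tau w < +oo)%E])
         Px (at_time X tau w) [set w' | B (X ^~ w')])%E }.

Definition regular_process (Px : 'rV[R]_d -> probability W R) X : Prop :=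
  forall (y : 'rV[R]_d) (O : set 'rV[R]_d), open O -> O !=set0 ->
    (0 < Px y [set w | exists2 t : R, (0 <= t)%R & O (X t w)])%E.

(* Since the five sigma-algebras contain the whole space, the product rule over
   the full family contains the rule over every subfamily. *)
Definition mutually_independent (Q : probability W R) X
    (theta1 theta2 : {mfun W >-> bool}) (U1 U2 : {mfun W >-> R}) : Prop :=
  forall (A : set W) (B1 B2 : set bool) (C1 C2 : set R),
    sigmaX X A -> measurable C1 -> measurable C2 ->
    Q (A `&` theta1 @^-1` B1 `&` theta2 @^-1` B2
         `&` U1 @^-1` C1 `&` U2 @^-1` C2)
    = (Q A * Q (theta1 @^-1` B1) * Q (theta2 @^-1` B2)
         * Q (U1 @^-1` C1) * Q (U2 @^-1` C2))%E.

Record randomisation (Q : probability W R) X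
    (theta1 theta2 : {mfun W >-> bool}) (U1 U2 : {mfun W >-> R})
    (p1 p2 : R) : Prop := {
  bernoulli_law1 : Q (theta1 @^-1` [set true]) = p1%:E ;
  bernoulli_law2 : Q (theta2 @^-1` [set true]) = p2%:E ;
  uniform_law1 : forall C : set R, measurable C ->
    Q (U1 @^-1` C) = uniform_prob (@ltr01 R) C ;
  uniform_law2 : forall C : set R, measurable C ->
    Q (U2 @^-1` C) = uniform_prob (@ltr01 R) C ;
  randomisation_independent : mutually_independent Q X theta1 theta2 U1 U2 }.

(* The class A.  Gamma_(0-) = 0 is encoded by Gamma_t = 0 for t < 0, so that
   monotonicity on R includes the possible jump Gamma_0 - Gamma_(0-) >= 0. *)
Record admissible X (Gamma : R -> W -> R) : Prop := {
  admissible_right_continuous : forall w (t : R), 0 <= t ->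
    Gamma s w @[s --> t^'+] --> Gamma t w ;
  admissible_nondecreasing : forall w s t, s <= t -> Gamma s w <= Gamma t w ;
  admissible_adapted : forall t : R, 0 <= t ->
    forall C : set R, measurable C -> filtrationX X t (Gamma t @^-1` C) ;
  admissible_start : forall w (t : R), t < 0 -> Gamma t w = 0 ;
  admissible_le1 : forall w (t : R), 0 <= t -> Gamma t w <= 1 }.

(* The class T^R_i, for U = U_i.  [ereal_inf set0 = +oo]. *)
Definition randomised_time X (U : W -> R) : set (W -> \bar R) :=
  [set tau | exists2 Gamma, admissible X Gamma &
     tau = (fun w => ereal_inf [set t%:E | t in
              [set t | 0 <= t /\ U w < Gamma t w]])].

Section payoff.
Context (Px : 'rV[R]_d -> probability W R) (X : R -> W -> 'rV[R]_d)
        (r : R) (g : 'rV[R]_d -> R).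

(* e^(- r tau), used only where tau is finite *)
Definition discount tau (w : W) : R := expR (- r * fine (tau w)).

Definition stopping_gain tau (w : W) : R :=
  discount tau w * g (at_time X tau w) * (tau w < +oo)%E%:R.

Definition value (y : 'rV[R]_d) : \bar R :=
  ereal_sup [set ('E_(Px y)[stopping_gain tau])%E | tau in stopping_time X].

Definition tau_value (w : W) : \bar R :=
  ereal_inf [set t%:E | t in
    [set t | 0 <= t /\ value (X t w) = (g (X t w))%:E]].

Record standing_assumption : Prop := {
  sup_integrable : forall y,
    (\int[Px y]_w ereal_sup [set (expR (- r * t) * g (X t w))%:E
                            | t in [set t : R | (0 <= t)%R]] < +oo)%E ;
  value_finite : forall y, value y \is a fin_num ;
  value_continuous : continuous (fun y => fine (value y)) ;
  value_transversality : forall y, {ae Px y, forall w,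
    limf_esup (fun t : R => (expR (- r * t))%:E * value (X t w)
                            * ((tau_value w == +oo)%E%:R)%:E)%E +oo = 0%E} }.

Definition stopping_region : set (R * 'rV[R]_d) :=
  [set q | 0 < q.1 < 1 /\
     ((1 - q.1)%:E * value q.2 <= ((1 - q.1 / 2) * g q.2)%:E)%E].

(* rho 1_{theta = 1} + oo 1_{theta = 0} *)
Definition if_present (theta : W -> bool) (rho : W -> \bar R) (w : W) : \bar R :=
  if theta w then rho w else +oo%E.

(* The payoff of a player stopping at sigma against an opponent whose effective
   stopping time is rho. *)
Definition payoff (sigma rho : W -> \bar R) (w : W) : R :=
  (g (at_time X sigma w) * (sigma w < rho w)%E%:R
   + 2^-1 * g (at_time X sigma w) * (sigma w == rho w)%:R)
  * (sigma w < +oo)%E%:R.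

Context (theta1 theta2 : W -> bool) (U1 U2 : W -> R).

Definition R1 (tau gamma : W -> \bar R) := payoff tau (if_present theta1 gamma).
Definition R2 (tau gamma : W -> \bar R) := payoff gamma (if_present theta2 tau).

Definition J1 (tau gamma : W -> \bar R) (y : 'rV[R]_d) : \bar R :=
  ('E_(Px y)[fun w => (discount tau w * R1 tau gamma w)%R])%E.
Definition J2 (tau gamma : W -> \bar R) (y : 'rV[R]_d) : \bar R :=
  ('E_(Px y)[fun w => (discount gamma w * R2 tau gamma w)%R])%E.

Definition nash_equilibrium (y : 'rV[R]_d) (taus gammas : W -> \bar R) : Prop :=
  [/\ randomised_time X U1 taus, randomised_time X U2 gammas,
      forall tau, randomised_time X U1 tau ->
        (J1 tau gammas y <= J1 taus gammas y)%E &
      forall gamma, randomised_time X U2 gamma ->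
        (J2 taus gamma y <= J2 taus gammas y)%E].

End payoff.
End process.

(* Main.v *)
From HB Require Import structures.
Require Import Defs.
From mathcomp Require Import all_boot all_order all_algebra.
From mathcomp Require Import all_classical all_reals all_analysis
  measurable_realfun.
From mathcomp Require Import ring.

Set Implicit Arguments.
Unset Strict Implicit.
Unset Printing Implicit Defensive.

Import Order.TTheory GRing.Theory Num.Theory.
Import numFieldNormedType.Exports.

Local Open Scope classical_set_scope.
Local Open Scope ring_scope.

(** Suppose that the opponent stops at time 0, a.s.  A player who stops at once
    as well receives [g x / 2] if the opponent is present (probability [p]) and
    [g x] otherwise, that is [(1 - p / 2) g x] on average.  A player who waits
    receives something only if the opponent is absent, hence at most
    [(1 - p) V x], and the stopping condition says precisely that this is not
    better.

    The point is that a randomised time may stop at once on one event and wait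
    on another, and mix the two according to the player's knowledge of the path.
    Two facts rule out a profit from mixing.

    - The randomisation device.  A randomised time is [level_time Gamma (U w) w],
      where [level_time Gamma u] is the first time at which [Gamma] exceeds [u].
      Since [U] and the presence of the opponent are independent of [X], the
      level and the presence can be integrated out separately ([freezing]): the
      expected payoff is an average over [u] of expected payoffs of the times
      [level_time Gamma u], each of which is an ordinary stopping time.

    - The path.  For a fixed level [u], the event that [level_time Gamma u] is 0
      belongs to the right-continuous sigma-algebra at time 0, and has therefore
      probability 0 or 1 ([blumenthal]).  If it has probability 1, the payoff is
      [(1 - p / 2) g x]; if it has probability 0, the payoff is at most
      [(1 - p) V x] ([frozen_payoff_le]).

    The two players are symmetric, so that one section serves both.  The stopping
    condition is assumed for [p1] only; it holds for [p2 >= p1] because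
    [(1 - p / 2) / (1 - p)] increases with [p] ([stopping_condition_le]).

    The integration over the level needs the payoff to be jointly measurable in
    the path and the level, with respect to the sigma-algebra generated by [X]:
    a larger one need not be independent of [U].  For this reason [W] is also
    regarded as a measurable type with the smaller sigma-algebra of [X].  Joint
    measurability comes from the continuity of the paths
    ([measurable_at_random_time]). *)

(** * Freezing an independent random variable *)

Section freezing.
Context (R : realType) (disp : measure_display) (W : measurableType disp)
  (Q : probability W R).

Lemma ge0_integral_mrestr (B : set W) (mB : measurable B) (f : W -> \bar R) :
  measurable_fun [set: W] f -> (forall w, 0 <= f w)%E ->
  (\int[mrestr Q mB]_w f w = \int[Q]_(w in B) f w)%E.
Proof.
move=> mf f0.
have mBC : measurable (~` B) by exact: measurableC.
rewrite -(setUv B) ge0_integral_setU//; last 2 first.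
- by rewrite setUv.
- exact/disj_setPCl.
rewrite [X in (_ + X)%E]null_set_integral//; last 2 first.
- exact: measurable_funTS.
- by rewrite /= /mrestr setICl measure0.
rewrite adde0; apply: eq_measure_integral => A mA AB.
by rewrite /= /mrestr setIidl.
Qed.

(** [G] generates a sub-sigma-algebra of that of [W].  The integrand depends on
    [w] only through this sub-sigma-algebra, which is what makes independence
    from it sufficient. *)
Section freezing_lemma.
Variables (G : set (set W)) (F : g_sigma_algebraType G * R -> \bar R).
Hypotheses (Gm : <<s G >> `<=` measurable)
  (mF : measurable_fun [set: g_sigma_algebraType G * R] F)
  (F0 : forall z, (0 <= F z)%E).

Let mid : measurable_fun [set: W] (id : W -> g_sigma_algebraType G).
Proof. by move=> _ A mA; rewrite setTI; exact: Gm. Qed.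

(* the identity of [W], as a random variable with values in the coarser space *)
Let phi : {mfun W >-> g_sigma_algebraType G} :=
  HB.pack (id : W -> g_sigma_algebraType G)
    (isMeasurableFun.Build _ _ _ _ (id : W -> g_sigma_algebraType G) mid).

Let integral_phi u :
  (\int[distribution Q phi]_w F (w, u) = \int[Q]_w F (w, u))%E.
Proof. by rewrite ge0_integral_distribution//; exact: measurable_fun_pair1. Qed.

Lemma measurable_integral_section :
  measurable_fun [set: R] (fun u => \int[Q]_w F (w, u))%E.
Proof.
under eq_fun do rewrite -integral_phi.
exact: measurable_fun_fubini_tonelli_G.
Qed.

(** Under [Q] restricted to [B], the joint law of [w] (seen through [G]) and
    [U w] is a product measure, by independence and the uniqueness of product
    measures; the formula is then Tonelli's theorem. *)
Lemma freezing (U : {mfun W >-> R}) (B : set W) :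
  measurable B ->
  (forall A C, <<s G >> A -> measurable C ->
    Q (A `&` B `&` U @^-1` C) = (Q A * Q B * Q (U @^-1` C))%E) ->
  (\int[Q]_(w in B) F (w, U w) =
   Q B * \int[distribution Q U]_u \int[Q]_w F (w, u))%E.
Proof.
move=> mB indep.
pose h (w : W) : g_sigma_algebraType G * R := (w, U w).
have mh : measurable_fun [set: W] h.
  by apply: measurable_fun_pair => //; exact: measurable_funP.
(* [m1 \x distribution Q U] and [m'] are two expressions of the joint law on
   [B]: a product, with the mass [Q B] put on its first factor, and a
   pushforward. *)
have k0 : 0 <= fine (Q B) by exact: fine_ge0.
pose m1 : {sigma_finite_measure set (g_sigma_algebraType G) -> \bar R} :=
  mscale (NngNum k0) (distribution Q phi).
pose m' : {measure set (g_sigma_algebraType G * R) -> \bar R} :=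
  measure_function_pushforward__canonical__measure_function_Measure
    (mrestr Q mB) mh.
have prodE D : measurable D -> (m1 \x distribution Q U)%E D = m' D.
  apply: product_measure_unique => A C mA mC.
  rewrite /= /pushforward /mrestr/= /mscale/= /distribution /pushforward/=.
  rewrite fineK ?fin_num_measure// (muleC (Q B)) -indep//; congr (Q _).
  by apply/seteqP; split => w /= [[]].
transitivity (\int[m']_z F z)%E.
  rewrite ge0_integral_pushforward//= preimage_setT ge0_integral_mrestr//.
  exact: measurableT_comp.
transitivity (\int[m1 \x distribution Q U]_z F z)%E.
  by apply: eq_measure_integral => D mD _; exact/esym/prodE.
rewrite fubini_tonelli2//.
rewrite (eq_integral (fun u => Q B * \int[Q]_w F (w, u)))%E; last first.
  move=> u _; rewrite /fubini_G ge0_integral_mscale//; last first.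
    exact: measurable_fun_pair1.
  by rewrite integral_phi /= fineK ?fin_num_measure.
rewrite ge0_integralZl//; first exact: measurable_integral_section.
by move=> u _; exact: integral_ge0.
Qed.

End freezing_lemma.

End freezing.

(** * Evaluating a continuous process at a random time *)

Section random_time.
Context (R : realType) (disp : measure_display) (T : measurableType disp).

Lemma cvg_truncn_div (a : R) : 0 <= a ->
  (Num.truncn (a * n.+1%:R))%:R / n.+1%:R @[n --> \oo] --> a.
Proof.
move=> a0; apply: (@squeeze_cvgr _ _ _ _ (fun n => a - n.+1%:R^-1) (cst a)).
- near=> n; have n0 : (0 : R) < n.+1%:R by rewrite ltr0n.
  have an0 : 0 <= a * n.+1%:R by rewrite mulr_ge0// ltW.
  have /andP[h1 h2] := truncn_itv an0.
  rewrite ler_pdivrMr// h1 andbT ler_pdivlMr// mulrBl mulVf ?gt_eqF//.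
  by rewrite lerBlDr natr1 ltW.
- rewrite -[X in _ --> X]subr0; apply: cvgB; first exact: cvg_cst.
  exact: cvg_harmonic.
- exact: cvg_cst.
Unshelve. all: by end_near. Qed.

(** Round [s z] down to the grid of mesh [1 / n.+1].  The rounded time takes
    countably many values, so that measurability at fixed times suffices; it
    stays nonnegative, so that continuity on [0, +oo[ suffices for the limit. *)
Lemma measurable_at_random_time (Z : R -> T -> R) (s : T -> R) :
  (forall t, 0 <= t -> measurable_fun [set: T] (Z t)) ->
  (forall z, {within [set t | 0 <= t], continuous (Z ^~ z)}) ->
  measurable_fun [set: T] s -> (forall z, 0 <= s z) ->
  measurable_fun [set: T] (fun z => Z (s z) z).
Proof.
move=> mZ cZ ms s0.
pose t_ n k : R := k%:R / n.+1%:R.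
have t0 n k : 0 <= t_ n k by rewrite divr_ge0.
pose k_ n z := Num.truncn (s z * n.+1%:R).
apply: (@measurable_fun_cvg _ _ _ _ (fun n z => Z (t_ n (k_ n z)) z)).
  move=> n _ Y mY; rewrite setTI.
  rewrite (_ : _ @^-1` _ =
      \bigcup_k ([set z | k_ n z = k] `&` Z (t_ n k) @^-1` Y)).
    apply: bigcupT_measurable => k; apply: measurableI; last first.
      by rewrite -[X in measurable X]setTI; exact: mZ.
    rewrite (_ : [set _ | _] =
        s @^-1` [set x | k%:R <= x * n.+1%:R < k.+1%:R]); last first.
      apply/seteqP; split => z /=; rewrite /k_.
        by move=> <-; exact/truncn_itv/mulr_ge0.
      by move=> h; exact: truncn_def.
    rewrite -[X in measurable X]setTI; apply: ms => //.
    rewrite (_ : [set _ | _] = `[t_ n k, t_ n k.+1[%classic)//.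
    apply/seteqP; split => x /=; rewrite in_itv/=;
      by rewrite /t_ ler_pdivrMr ?ltr_pdivlMr ?ltr0n.
  apply/seteqP; split => [z Yz|z [k _ [/= <-//]]].
  by exists (k_ n z).
move=> z _; have /subspace_continuousP/(_ (s z) (s0 z)) := cZ z.
apply: cvg_comp => A /= [e e0 eA].
have /(@cvgr_dist_lt _ _)/(_ _ e0)  := cvg_truncn_div (s0 z).
apply: filterS => n; exact: (fun h => eA _ h (t0 _ _)).
Qed.

End random_time.

(** * Measurability of the payoffs *)

Lemma measurable_fun_continuous_borelRd (R : realType) (d : nat)
    (g : 'rV[R]_d -> R) :
  continuous g -> measurable_fun [set: borelRd R d] (g : borelRd R d -> R).
Proof.
move=> cg; apply: (measurability _ (RGenOInfty.measurableE R)).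
move=> _ [_ [r ->] <-]; rewrite setTI; apply: sub_sigma_algebra.
apply: open_comp => [x _ |]; first exact: cg.
by rewrite set_itvoy; exact: open_gt.
Qed.

(** The space [W] is arbitrary here because these lemmas are used twice: for the
    random times themselves, and for functions of a path and a level. *)
Section process_measurability.
Context (R : realType) (d : nat) (disp : measure_display)
  (W : measurableType disp) (X : R -> W -> 'rV[R]_d).
Hypothesis mX : forall t : R, 0 <= t ->
  measurable_fun [set: W] (X t : W -> borelRd R d).
Hypothesis cX : forall w, {within [set t | 0 <= t], continuous (X ^~ w)}.

Lemma sigmaX_measurable : sigmaX X `<=` measurable.
Proof.
apply: smallest_sub; first exact: sigma_algebra_measurable.
move=> _ [u [V [u0 oV ->]]]; rewrite -[X in measurable X]setTI.
by apply: mX => //; exact: sub_sigma_algebra.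
Qed.

Lemma measurable_at_time (g : 'rV[R]_d -> R) (tau : W -> \bar R) :
  continuous g -> measurable_fun [set: W] tau -> (forall w, 0 <= tau w)%E ->
  measurable_fun [set: W] (fun w => g (at_time X tau w)).
Proof.
move=> cg mtau tau0.
apply: (measurable_at_random_time (Z := fun t w => g (X t w))
  (s := fun w => fine (tau w))).
- move=> t t0; apply: measurableT_comp (mX t0).
  exact: measurable_fun_continuous_borelRd.
- by move=> w t; apply: continuous_comp; [exact: cX|exact: cg].
- exact: measurableT_comp.
- by move=> w; exact: fine_ge0.
Qed.

Lemma measurable_discount (r : R) (tau : W -> \bar R) :
  measurable_fun [set: W] tau -> measurable_fun [set: W] (discount r tau).
Proof.
move=> mtau; apply: measurableT_comp => //; apply: measurable_funM => //.
exact: measurableT_comp.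
Qed.

Lemma measurable_natr_bool (f : W -> bool) :
  measurable_fun [set: W] f ->
  measurable_fun [set: W] (fun w => (f w)%:R : R).
Proof.
move=> mf; rewrite (_ : (fun _ => _) = fun w => if f w then 1 else 0).
  exact: measurable_fun_ifT.
by apply/funext => w; case: (f w).
Qed.

Lemma measurable_stopping_gain (r : R) (g : 'rV[R]_d -> R) (tau : W -> \bar R) :
  continuous g -> measurable_fun [set: W] tau -> (forall w, 0 <= tau w)%E ->
  measurable_fun [set: W] (stopping_gain X r g tau).
Proof.
move=> cg mtau tau0; apply: measurable_funM; first apply: measurable_funM.
- exact: measurable_discount.
- exact: measurable_at_time.
- by apply: measurable_natr_bool; exact: measurable_fun_lte.
Qed.

Lemma measurable_payoff (g : 'rV[R]_d -> R) (tau rho : W -> \bar R) :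
  continuous g -> measurable_fun [set: W] tau -> (forall w, 0 <= tau w)%E ->
  measurable_fun [set: W] rho ->
  measurable_fun [set: W] (payoff X g tau rho).
Proof.
move=> cg mtau tau0 mrho; have mg := measurable_at_time cg mtau tau0.
apply: measurable_funM; last first.
  by apply: measurable_natr_bool; exact: measurable_fun_lte.
apply: measurable_funD; apply: measurable_funM => //.
- by apply: measurable_natr_bool; exact: measurable_fun_lte.
- exact: measurable_funM.
- by apply: measurable_natr_bool; exact: measurable_fun_eqe.
Qed.

End process_measurability.

(** * Crossing times of the levels of an increasing process *)

Section hitting.
Context (R : realType) (d : nat) (disp : measure_display)
  (W : measurableType disp) (X : R -> W -> 'rV[R]_d).

Lemma filtrationX_sigmaX (t : R) : filtrationX X t `<=` sigmaX X.
Proof.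
move=> A /(_ (t + 1)) /=; rewrite ltrDl ltr01 => /(_ isT).
apply: sub_sigma_algebra2 => B [u [V [/andP[u0 us] oV ->]]].
by exists u, V.
Qed.

Lemma filtrationX_le (s t : R) : s <= t -> filtrationX X s `<=` filtrationX X t.
Proof. by move=> st A FA u /= tu; apply: FA => /=; exact: le_lt_trans tu. Qed.

(** A randomised stopping time, with the random level frozen at [u]. *)
Definition level_time (Gamma : R -> W -> R) (u : R) (w : W) : \bar R :=
  ereal_inf [set t%:E | t in [set t | 0 <= t /\ u < Gamma t w]].

Lemma level_time_ge0 Gamma u w : (0 <= level_time Gamma u w)%E.
Proof. by apply: le_ereal_inf_tmp => _ [t [t0 _] <-]; rewrite lee_fin. Qed.

(** The step [e] is free so that, in the proof that level times are stopping
    times, all the times involved can be kept below a given bound [s > t]. *)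
Lemma level_time_leP Gamma u w (t e : R) : admissible X Gamma ->
  0 <= t -> 0 < e ->
  ((level_time Gamma u w <= t%:E)%E <->
   (forall n, u < Gamma (t + e / n.+1%:R) w)).
Proof.
move=> aG t0 e0.
have en0 n : 0 < e / n.+1%:R by rewrite divr_gt0.
split=> [ht n|h].
  have /ereal_inf_lt[_ [s [s0 us] <-]] :
      (level_time Gamma u w < (t + e / n.+1%:R)%:E)%E.
    by rewrite (le_lt_trans ht)// lte_fin ltrDl.
  rewrite lte_fin => /ltW st; apply: (lt_le_trans us).
  exact: admissible_nondecreasing aG _ _ _ st.
apply/lee_addgt0Pr => eps eps0.
pose n := Num.truncn (e / eps).
apply: (@le_trans _ _ (t + e / n.+1%:R)%:E).
  by apply: ereal_inf_lbound; exists (t + e / n.+1%:R) => //=; split;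
    rewrite ?addr_ge0 // ltW.
rewrite -EFinD lee_fin lerD2l ler_pdivrMr// mulrC -ler_pdivrMr// ltW//.
by have /andP[] := truncn_itv (divr_ge0 (ltW e0) (ltW eps0)).
Qed.

(** The infimum need not be attained, so that one has to look slightly beyond
    [t]; the right-continuity of the filtration allows this. *)
Lemma stopping_time_level_time Gamma u : admissible X Gamma ->
  stopping_time X (level_time Gamma u).
Proof.
move=> aG; split=> [w|t t0]; first exact: level_time_ge0.
move=> s /= ts.
(* all the times [t + e / n.+1] lie strictly before [s] *)
pose e := (s - t) / 2.
have e0 : 0 < e by rewrite divr_gt0// subr_gt0.
rewrite (_ : [set _ | _] = \bigcap_n [set w | u < Gamma (t + e / n.+1%:R) w]).
  apply: (@bigcapT_measurable _ (g_sigma_algebraType [set A | exists u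
    (O : set 'rV[R]_d), [/\ 0 <= u <= s, open O & A = X u @^-1` O]])) => n.
  have en : e / n.+1%:R <= e by rewrite ler_pdivrMr// ler_peMr ?ler1n// ltW.
  have tn0 : 0 <= t + e / n.+1%:R by exact: addr_ge0 (divr_ge0 (ltW e0) _).
  have := admissible_adapted aG tn0 (measurable_itv `]u, +oo[).
  move=> /(_ s) /=.
  have -> : Gamma (t + e / n.+1%:R) @^-1` `]u, +oo[ =
      [set w | u < Gamma (t + e / n.+1%:R) w].
    by apply/seteqP; split => w /=; rewrite in_itv/= andbT.
  apply; rewrite -ltrBrDl (le_lt_trans en)// /e ltr_pdivrMr//.
  by rewrite ltr_pMr ?subr_gt0// ltr1n.
apply/seteqP; split => w /=.
  by move=> /(level_time_leP _ _ aG t0 e0) h n _; exact: h.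
by move=> h; apply/(level_time_leP _ _ aG t0 e0) => n; exact: h.
Qed.

End hitting.

Section observed_process.
Context (R : realType) (d : nat) (disp : measure_display)
  (W : measurableType disp) (X : R -> W -> 'rV[R]_d).

Definition sigmaX_gen : set (set W) :=
  [set A | exists u (O : set 'rV[R]_d), [/\ 0 <= u, open O & A = X u @^-1` O]].

Local Notation WX := (g_sigma_algebraType sigmaX_gen).

Lemma measurable_observed (t : R) : 0 <= t ->
  measurable_fun [set: WX] (X t : WX -> borelRd R d).
Proof.
move=> t0; apply: (@measurability _ _ _ (borelRd R d) _ _ (@open 'rV[R]_d)) => //.
move=> _ [V oV <-]; rewrite setTI; apply: sub_sigma_algebra.
by exists t, V.
Qed.

(** Joint measurability in the path and the level, for the sigma-algebra of
    [X]: the hypothesis of [freezing]. *)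
Lemma measurable_level_time Gamma : admissible X Gamma ->
  measurable_fun [set: WX * R]
    (fun z => level_time Gamma z.2 (z.1 : W)).
Proof.
move=> aG; apply: (measurability _ (ErealGenOInfty.measurableE R)).
move=> _ [_ [t ->] <-]; rewrite setTI -setCitvl; apply: measurableC.
rewrite (_ : (fun _ => _) =
    [set z : WX * R | (level_time Gamma z.2 (z.1 : W) <= t%:E)%E]); last first.
  by apply/seteqP; split => z /=; rewrite in_itv.
have [t0|t0] := ltP t 0.
  rewrite (_ : [set _ | _] = set0)//.
  apply/seteqP; split => z //= h.
  by have := le_trans (level_time_ge0 Gamma z.2 z.1) h; rewrite lee_fin leNgt t0.
rewrite (_ : [set _ | _] =
    \bigcap_n [set z : WX * R | z.2 < Gamma (t + 1 / n.+1%:R) z.1]).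
  apply: bigcapT_measurable => n.
  have tn0 : 0 <= t + 1 / n.+1%:R by exact: addr_ge0.
  have mG : measurable_fun [set: WX] (Gamma (t + 1 / n.+1%:R) : WX -> R).
    move=> _ C mC; rewrite setTI.
    exact: (filtrationX_sigmaX (admissible_adapted aG tn0 mC)).
  rewrite -[X in measurable X]setTI.
  have := @measurable_fun_ltr _ (WX * R)%type R setT snd
    (Gamma (t + 1 / n.+1%:R) \o fst) measurable_snd
    (measurableT_comp mG measurable_fst) measurableT [set true].
  exact.
apply/seteqP; split => z /=.
  by move=> /(level_time_leP _ _ aG t0 ltr01) h n _; exact: h.
by move=> h; apply/(level_time_leP _ _ aG t0 ltr01) => n; exact: h.
Qed.

(** The strong Markov property is about sets of paths; this lemma allows its
    use for events. *)
Lemma sigmaX_path A : sigmaX X A ->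
  exists2 B : set (R -> 'rV[R]_d), path_sigma B & A = [set w | B (X ^~ w)].
Proof.
pose f (w : W) : R -> 'rV[R]_d := X ^~ w.
pose G' : set (set (R -> 'rV[R]_d)) := [set B | exists u (V : set 'rV[R]_d),
  [/\ 0 <= u, open V & B = [set z | V (z u)]]].
move=> sA; suff [B sB <-] : preimage_set_system [set: W] f <<s G' >> A.
  by exists B => //; rewrite setTI.
move: A sA; apply: smallest_sub.
  by apply: sigma_algebra_preimage; exact: smallest_sigma_algebra.
move=> _ [u [V [u0 oV ->]]]; exists [set z | V (z u)]; last by rewrite setTI.
by apply: sub_sigma_algebra; exists u, V.
Qed.

End observed_process.

(** * Blumenthal's zero-one law *)

Section zero_one.
Context (R : realType) (d : nat) (disp : measure_display)
  (W : measurableType disp) (P : probability W R)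
  (Px : 'rV[R]_d -> probability W R) (X : R -> W -> 'rV[R]_d).
Hypothesis hX : strong_markov_process P Px X.

Lemma ae_start y : {ae Px y, forall w, X 0 w = y}.
Proof.
have mV : measurable [set w | X 0 w = y].
  rewrite -[X in measurable X]setTI.
  apply: (process_measurable hX (lexx 0) (Y := [set y]) measurableT).
  rewrite -[X in measurable X]setCK; apply: measurableC.
  apply: sub_sigma_algebra; apply: closed_openC.
  exact/accessible_closed_set1/hausdorff_accessible.
exists (~` [set w | X 0 w = y]); split => //; first exact: measurableC.
by rewrite probability_setC// (kernel_start hX) subee.
Qed.

(** Apply the Markov property at time 0 to an event [A] that is both in the past
    and a property of the path.  As the path restarts from [y], this reads
    [Px y A = Px y A * Px y A]. *)
Lemma blumenthal y A : filtrationX X 0 A -> Px y A = 0%E \/ Px y A = 1%E.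
Proof.
move=> F0A.
have mA : measurable A.
  exact: (sigmaX_measurable (process_measurable hX) (filtrationX_sigmaX F0A)).
have [B sB AE] := sigmaX_path (filtrationX_sigmaX F0A).
have st0 : stopping_time X (cst 0%E).
  split => // t t0; rewrite (_ : [set _ | _] = setT).
    move=> s _; exact: (@measurableT _ (g_sigma_algebraType _)).
  by apply/seteqP; split => // w _ /=; rewrite lee_fin.
have sA : stopped_sigma X (cst 0%E) A.
  split => // t t0; rewrite (_ : [set _ | _] = setT).
    by rewrite setIT; exact: filtrationX_le F0A.
  by apply/seteqP; split => // w _ /=; rewrite lee_fin.
have := strong_markov hX y st0 sA sB.
rewrite (_ : [set w | B _] = A); last first.
  rewrite AE; apply: eq_set => w; congr (B _).
  by apply/funext => s; rewrite /= add0r.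
rewrite (_ : [set _ | _] = setT); last first.
  by apply/seteqP; split => // w _ /=; rewrite ltry.
rewrite setIT setIid -AE => PA.
have : (\int[Px y]_(w in A) Px (at_time X (cst 0%E) w) A = Px y A * Px y A)%E.
  rewrite -integral_cst//; apply: ge0_ae_eq_integral => //.
  - apply: (measurableT_comp (kernel_measurable hX mA)).
    exact: measurable_funTS (process_measurable hX (lexx 0)).
  - have := ae_start y; apply: filterS => w; rewrite /at_time/= => -> _.
    by [].
rewrite -PA.
have : Px y A \is a fin_num by exact: fin_num_measure.
case: (Px y A) => // a _; rewrite -EFinM => -[] /eqP.
rewrite -[X in X == _]mulr1 -subr_eq0 -mulrBr mulf_eq0 subr_eq0.
by case/orP => /eqP; [move=> ->; left|move=> <-; right].
Qed.

End zero_one.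

(** * A player facing an opponent who stops at once *)

Section opponent_stopping_at_once.
Context (R : realType) (d : nat) (disp : measure_display)
  (W : measurableType disp) (P : probability W R)
  (Px : 'rV[R]_d -> probability W R) (X : R -> W -> 'rV[R]_d).
Hypothesis hX : strong_markov_process P Px X.
Variables (r : R) (g : 'rV[R]_d -> R).
Hypotheses (g0 : forall y, 0 <= g y) (cg : continuous g).
Variables (x : 'rV[R]_d) (theta : {mfun W >-> bool}) (U : {mfun W >-> R}) (p : R).
Hypothesis theta_law : Px x (theta @^-1` [set true]) = p%:E.

Let mX := process_measurable hX.
Let cX := process_continuous hX.

Let mpre (b : bool) : measurable (theta @^-1` [set b]).
Proof. by rewrite -[X in measurable X]setTI; exact: measurable_funP. Qed.

Let theta_lawC : Px x (theta @^-1` [set false]) = (1 - p)%:E.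
Proof.
rewrite (_ : _ @^-1` _ = ~` (theta @^-1` [set true])).
  by rewrite probability_setC// theta_law.
by apply/seteqP; split => w /=; case: (theta w).
Qed.

Lemma randomised_timeE (V : W -> R) tau : randomised_time X V tau ->
  exists2 Gamma, admissible X Gamma & tau = fun w => level_time Gamma (V w) w.
Proof. by case=> Gamma aG ->; exists Gamma. Qed.

Lemma measurable_randomised_time (V : {mfun W >-> R}) tau :
  randomised_time X V tau -> measurable_fun [set: W] tau.
Proof.
move=> /randomised_timeE[Gamma aG ->].
pose WX := g_sigma_algebraType (sigmaX_gen X).
have mid : measurable_fun [set: W] (id : W -> WX).
  by move=> _ A mA; rewrite setTI; exact: (sigmaX_measurable mX).
have mpair : measurable_fun [set: W] (fun w => ((w : WX), V w)).
  by apply: measurable_fun_pair => //; exact: measurable_funP.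
exact: (measurableT_comp (measurable_level_time aG) mpair).
Qed.

Lemma randomised_time_ge0 (V : W -> R) tau w : randomised_time X V tau ->
  (0 <= tau w)%E.
Proof. by move=> /randomised_timeE[Gamma aG ->]; exact: level_time_ge0. Qed.

Lemma stopping_gain_ge0 tau w : 0 <= stopping_gain X r g tau w.
Proof. by rewrite !mulr_ge0// expR_ge0. Qed.

Lemma payoff_ge0 sigma rho w : 0 <= payoff X g sigma rho w.
Proof. by rewrite mulr_ge0// addr_ge0// !mulr_ge0. Qed.

Lemma ae_stopping_gain0 tau : {ae Px x, forall w, tau w = 0%E} ->
  {ae Px x, forall w, stopping_gain X r g tau w = g x}.
Proof.
apply: filterS2 (ae_start hX x) => w Xw tw.
rewrite /stopping_gain /discount /at_time tw /= Xw mulr0 expR0.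
by rewrite ltry !mulr1 mul1r.
Qed.

(** Split according to the presence of the opponent: a present opponent leaves
    only half of [g x], to a player who stops at once; an absent one leaves the
    gain of the single-player problem. *)
Lemma expected_payoffE (tau rho : W -> \bar R) :
  measurable_fun [set: W] tau -> (forall w, 0 <= tau w)%E ->
  measurable_fun [set: W] rho -> {ae Px x, forall w, rho w = 0%E} ->
  ('E_(Px x)[fun w => (discount r tau w *
      payoff X g tau (if_present theta rho) w)%R] =
   \int[Px x]_(w in theta @^-1` [set true])
     (2^-1 * g x * (tau w <= 0)%E%:R)%:E +
   \int[Px x]_(w in theta @^-1` [set false]) (stopping_gain X r g tau w)%:E)%E.
Proof.
move=> mtau tau0 mrho rho0; rewrite unlock.
pose f w := if theta w then 2^-1 * g x * (tau w <= 0)%E%:R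
            else stopping_gain X r g tau w.
have mf : measurable_fun [set: W] f.
  apply: measurable_fun_ifT; last exact: measurable_stopping_gain.
    exact: measurable_funP.
  apply: measurable_funM => //; apply: measurable_natr_bool.
  exact: measurable_fun_lee.
have f0 w : 0 <= f w.
  by rewrite /f; case: ifP => _; rewrite ?stopping_gain_ge0// !mulr_ge0.
transitivity (\int[Px x]_w (f w)%:E)%E.
  apply: ge0_ae_eq_integral => //.
  - apply/measurable_EFinP; apply: measurable_funM.
      exact: measurable_discount.
    apply: (measurable_payoff mX cX) => //.
    by apply: measurable_fun_ifT => //; exact: measurable_funP.
  - exact/measurable_EFinP.
  - by move=> w _; rewrite lee_fin mulr_ge0 ?payoff_ge0// expR_ge0.
  - by move=> w _; rewrite lee_fin.
  apply: filterS2 (ae_start hX x) rho0 => w Xw rw _; congr EFin.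
  rewrite /f /payoff /if_present; case: (theta w).
    rewrite rw ltNge tau0 mulr0 add0r eq_le tau0 andbT.
    case: (leP (tau w) 0%E) => [tau_le0|_]; last by rewrite !(mulr0, mul0r).
    have tauw : tau w = 0%E by apply/eqP; rewrite eq_le tau_le0 tau0.
    by rewrite /discount /at_time tauw /= Xw mulr0 expR0 ltry !mulr1 mul1r.
  rewrite /stopping_gain ltey; case: eqVneq => _; first by rewrite !mulr0.
  by rewrite !mulr1 mulr0 addr0.
rewrite (_ : setT = theta @^-1` [set true] `|` theta @^-1` [set false]); last first.
  by apply/seteqP; split => w //= _; case: (theta w); [left|right].
rewrite ge0_integral_setU//=; last 3 first.
- exact/measurable_EFinP/measurable_funTS.
- by move=> w _; rewrite lee_fin.
- by apply/disj_set2P; apply/seteqP; split => w //= [->].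
by congr (_ + _)%E; apply: eq_integral => w; rewrite inE /f /= => ->.
Qed.

Lemma expected_payoff_zero (tau rho : W -> \bar R) :
  measurable_fun [set: W] tau -> (forall w, 0 <= tau w)%E ->
  measurable_fun [set: W] rho ->
  {ae Px x, forall w, tau w = 0%E} -> {ae Px x, forall w, rho w = 0%E} ->
  ('E_(Px x)[fun w => (discount r tau w *
      payoff X g tau (if_present theta rho) w)%R] = ((1 - p / 2) * g x)%:E)%E.
Proof.
move=> mtau tau0 mrho tauE rhoE; rewrite expected_payoffE//.
rewrite (ge0_ae_eq_integral (g := cst (2^-1 * g x)%:E))//; last 4 first.
- apply/measurable_EFinP/measurable_funTS/measurable_funM => //.
  by apply: measurable_natr_bool; exact: measurable_fun_lee.
- by move=> w _; rewrite lee_fin !mulr_ge0.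
- by move=> w _; rewrite lee_fin mulr_ge0.
- by apply: filterS tauE => w -> _; rewrite lexx mulr1.
rewrite (ge0_ae_eq_integral (f := fun w => (stopping_gain X r g tau w)%:E)
  (g := cst (g x)%:E))//; last 4 first.
- by apply/measurable_EFinP/measurable_funTS; exact: measurable_stopping_gain.
- by move=> w _; rewrite lee_fin stopping_gain_ge0.
- by move=> w _; rewrite lee_fin.
- by apply: filterS (ae_stopping_gain0 tauE) => w -> _.
rewrite !integral_cst//.
rewrite [X in (_ * X + _)%E]theta_law [X in (_ + _ * X)%E]theta_lawC.
rewrite -!EFinM -EFinD.
by congr EFin; field.
Qed.


(** The bound at a fixed level.  Without the zero-one law the player could wait
    on an event of intermediate probability, and the gain on that event alone
    would not be controlled by [V x]. *)
Lemma frozen_payoff_le Gamma (u : R) : admissible X Gamma -> 0 <= p <= 1 ->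
  ((1 - p)%:E * value Px X r g x <= ((1 - p / 2) * g x)%:E)%E ->
  (p%:E * \int[Px x]_w (2^-1 * g x * (level_time Gamma u w <= 0)%E%:R)%:E +
   (1 - p)%:E * \int[Px x]_w (stopping_gain X r g (level_time Gamma u) w)%:E
   <= ((1 - p / 2) * g x)%:E)%E.
Proof.
move=> aG /andP[p0 p1] hV.
have st := stopping_time_level_time u aG.
have mtau : measurable_fun [set: W] (level_time Gamma u).
  by apply: (@measurable_randomised_time (cst u)); exists Gamma.
pose A := [set w | (level_time Gamma u w <= 0)%E].
have F0A : filtrationX X 0 A by exact: (st.2 _ (lexx 0)).
have mA : measurable A by exact: sigmaX_measurable (filtrationX_sigmaX F0A).
have -> : (\int[Px x]_w (2^-1 * g x * (level_time Gamma u w <= 0)%E%:R)%:E =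
           (2^-1 * g x)%:E * Px x A)%E.
  rewrite -[X in (_ * Px x X)%E]setIT -integral_indic// -ge0_integralZl//.
  - apply: eq_integral => w _; rewrite -EFinM indicE.
    suff -> : (w \in A) = (level_time Gamma u w <= 0)%E by [].
    by apply/idP/idP; rewrite inE.
  - by apply/measurable_EFinP; exact: measurable_indic.
  - by rewrite lee_fin mulr_ge0.
have [PA0|PA1] := blumenthal hX x F0A.
  rewrite PA0 !mule0 add0e; apply: le_trans hV.
  apply: lee_wpmul2l; first by rewrite lee_fin subr_ge0.
  apply: ereal_sup_ubound; exists (level_time Gamma u) => //.
  by rewrite unlock.
have tau0 : {ae Px x, forall w, level_time Gamma u w = 0%E}.
  exists (~` A); split; first exact: measurableC.
    by rewrite probability_setC// PA1 subee.
  apply: subsetC => w /= Aw; apply/eqP; rewrite eq_le Aw.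
  exact: level_time_ge0.
rewrite PA1 (ge0_ae_eq_integral (g := cst (g x)%:E)
  (f := fun w => (stopping_gain X r g _ w)%:E))//; last 4 first.
- apply/measurable_EFinP; apply: measurable_stopping_gain => // w.
  exact: level_time_ge0.
- by move=> w _; rewrite lee_fin stopping_gain_ge0.
- by move=> w _; rewrite lee_fin.
- by apply: filterS (ae_stopping_gain0 tau0) => w -> _.
rewrite integral_cst// [X in (_ + _ * (_ * X))%E]probability_setT !mule1.
rewrite -!EFinM -EFinD lee_fin.
by rewrite le_eqVlt; apply/orP; left; apply/eqP; field.
Qed.

Hypothesis indep : forall A (B : set bool) (C : set R),
  sigmaX X A -> measurable C ->
  Px x (A `&` theta @^-1` B `&` U @^-1` C) =
  (Px x A * Px x (theta @^-1` B) * Px x (U @^-1` C))%E.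

(** [expected_payoffE] splits the payoff in two, and each part is an integral over
    the levels by [freezing], so that the bound at a fixed level can be
    integrated. *)
Lemma expected_payoff_le (tau rho : W -> \bar R) : 0 <= p <= 1 ->
  ((1 - p)%:E * value Px X r g x <= ((1 - p / 2) * g x)%:E)%E ->
  randomised_time X U tau ->
  measurable_fun [set: W] rho -> {ae Px x, forall w, rho w = 0%E} ->
  ('E_(Px x)[fun w => (discount r tau w *
      payoff X g tau (if_present theta rho) w)%R] <= ((1 - p / 2) * g x)%:E)%E.
Proof.
move=> p01 hV tauU mrho rho0.
rewrite expected_payoffE//; last 2 first.
- exact: measurable_randomised_time tauU.
- by move=> w; exact: randomised_time_ge0 tauU.
have [Gamma aG ->] := randomised_timeE tauU.
have mtau := measurable_level_time aG.
pose WX := g_sigma_algebraType (sigmaX_gen X).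
pose F1 (z : WX * R) : \bar R :=
  (2^-1 * g x * (level_time Gamma z.2 (z.1 : W) <= 0)%E%:R)%:E.
pose F2 (z : WX * R) : \bar R :=
  (stopping_gain X r g (level_time Gamma z.2) (z.1 : W))%:E.
have mF1 : measurable_fun [set: WX * R] F1.
  apply/measurable_EFinP; apply: measurable_funM => //.
  by apply: measurable_natr_bool; exact: measurable_fun_lee.
have mF2 : measurable_fun [set: WX * R] F2.
  (* [F2] is the gain of a single random time on the product space, where the
     process ignores the level *)
  apply/measurable_EFinP.
  apply: (@measurable_stopping_gain _ _ _ (WX * R)%type (fun t z => X t z.1)
    _ _ r g (fun z => level_time Gamma z.2 z.1)) => //.
  - move=> t t0.
    apply: (@measurableT_comp _ _ _ _ _ _ (X t : WX -> borelRd R d)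
      _ (fst : WX * R -> WX)) => //.
    exact: measurable_observed.
  - by move=> z; exact: level_time_ge0.
have F10 z : (0 <= F1 z)%E by rewrite lee_fin !mulr_ge0.
have F20 z : (0 <= F2 z)%E by rewrite lee_fin stopping_gain_ge0.
have sXm := sigmaX_measurable mX.
rewrite (freezing sXm mF1 F10 (mpre true)); last by move=> *; exact: indep.
rewrite (freezing sXm mF2 F20 (mpre false)); last by move=> *; exact: indep.
have [p0 q0] : (0 <= p%:E)%E /\ (0 <= (1 - p)%:E)%E.
  by case/andP: p01 => p0 p1; rewrite !lee_fin subr_ge0.
rewrite [X in (X * _ + _)%E]theta_law [X in (_ + X * _)%E]theta_lawC.
have mI1 := measurable_integral_section (Px x) sXm mF1 F10.
have mI2 := measurable_integral_section (Px x) sXm mF2 F20.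
have I1 u : (0 <= \int[Px x]_w F1 (w, u))%E by exact: integral_ge0.
have I2 u : (0 <= \int[Px x]_w F2 (w, u))%E by exact: integral_ge0.
rewrite -!ge0_integralZl// -ge0_integralD//; last 4 first.
- by move=> u _; exact: mule_ge0.
- exact: measurable_funeM.
- by move=> u _; exact: mule_ge0.
- exact: measurable_funeM.
rewrite -[leRHS]mule1 -(@probability_setT _ _ _ (distribution (Px x) U)).
rewrite -integral_cst//; apply: ge0_le_integral => //.
- by move=> u _; rewrite adde_ge0// mule_ge0.
- by apply: emeasurable_funD; exact: measurable_funeM.
- by move=> u _; exact: frozen_payoff_le.
Qed.

End opponent_stopping_at_once.

(** * The equilibrium *)

Lemma uniform_prob_ge1 (R : realType) :
  uniform_prob (@ltr01 R) `[1, +oo[%classic = 0%E.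
Proof.
rewrite /uniform_prob integral_uniform_pdf.
rewrite (_ : _ `&` _ = [set 1]) ?integral_set1//.
apply/seteqP; split => z /=; rewrite !in_itv/= andbT.
  by case=> z1 /andP[_ z1']; apply/eqP; rewrite eq_le z1 z1'.
by move=> ->; rewrite lexx ler01.
Qed.

(** The process that jumps to 1 at time 0 exceeds every level below 1, and [U] is
    below 1 a.s. *)
Lemma randomised_time_zero (R : realType) (d : nat) (disp : measure_display)
    (W : measurableType disp) (Q : probability W R) (X : R -> W -> 'rV[R]_d)
    (U : {mfun W >-> R}) :
  (forall C : set R, measurable C -> Q (U @^-1` C) = uniform_prob (@ltr01 R) C) ->
  exists2 tau, randomised_time X U tau & {ae Q, forall w, tau w = 0%E}.
Proof.
move=> U01; pose Gamma (t : R) (w : W) : R := (0 <= t)%R%:R.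
have aG : admissible X Gamma.
  split => [w t t0|w s t st|t t0 C mC|w t t0|w t t0]; rewrite /Gamma.
  - rewrite t0; apply: cvg_near_cst; near=> s.
    by rewrite ltW// (le_lt_trans t0)//; near: s; exact: nbhs_right_gt.
  - by rewrite ler_nat; have [s0|//] := boolP (0 <= s); rewrite (le_trans s0 st).
  - have [CG|CG] := pselect (C (0 <= t)%R%:R).
      rewrite (_ : _ @^-1` _ = setT); last by apply/seteqP; split.
      by move=> s _; exact: (@measurableT _ (g_sigma_algebraType _)).
    rewrite (_ : _ @^-1` _ = set0); last by apply/seteqP; split.
    by move=> s _; exact: (@measurable0 _ (g_sigma_algebraType _)).
  - by rewrite leNgt t0.
  - by rewrite t0.
exists (fun w => level_time Gamma (U w) w); first by exists Gamma.
have mU : measurable (U @^-1` `[1, +oo[).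
  by rewrite -[X in measurable X]setTI; exact: measurable_funP.
exists (U @^-1` `[1, +oo[); split => //.
  by rewrite U01 ?uniform_prob_ge1.
move=> w /=; rewrite in_itv/= andbT leNgt => h; apply/negP => U1; apply: h.
apply/eqP; rewrite eq_le level_time_ge0 andbT.
by apply: ereal_inf_lbound; exists 0 => //=; rewrite /Gamma lexx.
Unshelve. all: by end_near. Qed.

(** Multiply by [1 - p > 0] instead of dividing by [1 - q], which may vanish.  The
    two bounds then differ by [(q - p) / 2 * G]. *)
Lemma stopping_condition_le (R : realType) (p q G : R) (V : \bar R) :
  V \is a fin_num -> 0 <= G -> p <= q -> q <= 1 -> p < 1 ->
  ((1 - p)%:E * V <= ((1 - p / 2) * G)%:E)%E ->
  ((1 - q)%:E * V <= ((1 - q / 2) * G)%:E)%E.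
Proof.
case: V => // v _ G0 pq q1 p1; rewrite -!EFinM !lee_fin => h.
have p1' : 0 < 1 - p by rewrite subr_gt0.
rewrite -(ler_pM2l p1').
apply: (@le_trans _ _ ((1 - q) * ((1 - p / 2) * G))).
  by rewrite mulrCA ler_wpM2l// subr_ge0.
rewrite -subr_ge0 (_ : _ - _ = (q - p) / 2 * G); last by field.
by rewrite !mulr_ge0 ?subr_ge0.
Qed.

Theorem theorem5p2 (R : realType) (d : nat) (hd : (0 < d)%N)
    (disp : measure_display) (W : measurableType disp)
    (P : probability W R) (Px : 'rV[R]_d -> probability W R)
    (X : R -> W -> 'rV[R]_d)
    (theta1 theta2 : {mfun W >-> bool}) (U1 U2 : {mfun W >-> R})
    (r : R) (g : 'rV[R]_d -> R) (p1 p2 : R)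
    (hX : strong_markov_process P Px X)
    (hreg : regular_process Px X)
    (hP : randomisation P X theta1 theta2 U1 U2 p1 p2)
    (hPx : forall y, randomisation (Px y) X theta1 theta2 U1 U2 p1 p2)
    (hr : 0 <= r)
    (hg0 : forall y, 0 <= g y)
    (hgc : continuous g)
    (hgsup : (0 < ereal_sup [set (g y)%:E | y in [set: 'rV[R]_d]])%E)
    (hstanding : standing_assumption Px X r g)
    (hp1 : 0 < p1) (hp12 : p1 <= p2) (hp2 : p2 <= 1) (hp1lt : p1 < 1)
    (x : 'rV[R]_d)
    (hS : stopping_region Px X r g (p1, x)) :
  (exists taus gammas : W -> \bar R,
     [/\ randomised_time X U1 taus, randomised_time X U2 gammas,
         {ae Px x, forall w, taus w = 0%E} &
         {ae Px x, forall w, gammas w = 0%E}]) /\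
  (forall taus gammas : W -> \bar R,
     randomised_time X U1 taus -> randomised_time X U2 gammas ->
     {ae Px x, forall w, taus w = 0%E} ->
     {ae Px x, forall w, gammas w = 0%E} ->
     [/\ nash_equilibrium Px X r g theta1 theta2 U1 U2 x taus gammas,
         J1 Px X r g theta1 taus gammas x = ((1 - p1 / 2) * g x)%:E &
         J2 Px X r g theta2 taus gammas x = ((1 - p2 / 2) * g x)%:E]).
Proof.
have [law1 law2 unif1 unif2 indep] := hPx x.
split.
  have [taus htaus taus0] := randomised_time_zero X unif1.
  have [gammas hgammas gammas0] := randomised_time_zero X unif2.
  by exists taus, gammas; split.
move=> taus gammas htaus hgammas taus0 gammas0.
have [_ /= hV1] := hS.
have hV2 := stopping_condition_le (value_finite hstanding x) (hg0 x)
  hp12 hp2 hp1lt hV1.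
have p1_01 : 0 <= p1 <= 1 by rewrite !ltW.
have p2_01 : 0 <= p2 <= 1 by rewrite (le_trans (ltW hp1) hp12).
have indep1 A B C : sigmaX X A -> measurable C ->
    Px x (A `&` theta1 @^-1` B `&` U1 @^-1` C) =
    (Px x A * Px x (theta1 @^-1` B) * Px x (U1 @^-1` C))%E.
  move=> sA mC; have := indep A B setT C setT sA mC measurableT.
  by rewrite !preimage_setT !setIT !probability_setT !mule1.
have indep2 A B C : sigmaX X A -> measurable C ->
    Px x (A `&` theta2 @^-1` B `&` U2 @^-1` C) =
    (Px x A * Px x (theta2 @^-1` B) * Px x (U2 @^-1` C))%E.
  move=> sA mC; have := indep A setT B setT C sA measurableT mC.
  by rewrite !preimage_setT !setIT !probability_setT !mule1.
have mtaus := measurable_randomised_time hX htaus.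
have mgammas := measurable_randomised_time hX hgammas.
have ge0_taus w := randomised_time_ge0 w htaus.
have ge0_gammas w := randomised_time_ge0 w hgammas.
have J1E : J1 Px X r g theta1 taus gammas x = ((1 - p1 / 2) * g x)%:E.
  exact: (expected_payoff_zero hX r hg0 hgc law1).
have J2E : J2 Px X r g theta2 taus gammas x = ((1 - p2 / 2) * g x)%:E.
  exact: (expected_payoff_zero hX r hg0 hgc law2).
split => //; split => // [tau htau|gamma hgamma].
  rewrite J1E.
  exact: (expected_payoff_le hX hg0 hgc law1 indep1 p1_01 hV1 htau).
rewrite J2E.
exact: (expected_payoff_le hX hg0 hgc law2 indep2 p2_01 hV2 hgamma).
Qed.
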